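(* With respect to $\mu_{\mathcal{L}_n}$, almost every lattice in $\mathcal{L}_n$ has Mordell constant equal to $1$.
   Context: $n$ is a positive integer, $G=\mathrm{SL}_n(\mathbb{R})$, $\mathcal{L}_n\cong G/\mathrm{SL}_n(\mathbb{Z})$ is the space of lattices in $\mathbb{R}^n$ of covolume $1$, and $\mu_{\mathcal{L}_n}$ is the unique $G$-invariant Borel probability measure on $\mathcal{L}_n$. Mordell constant: a symmetric box is a set $[-a_1,a_1]\times\cdots\times[-a_n,a_n]$ with $a_i>0$; it is admissible for a lattice $\Lambda\subset\mathbb{R}^n$ if its interior contains no nonzero point of $\Lambda$. The Mordell constant is $\kappa(\Lambda)=\sup_{\mathcal{B}}\frac{\mathrm{Vol}(\mathcal{B})}{2^n\mathrm{Vol}(\Lambda)}$, the supremum over symmetric boxes $\mathcal{B}$ admissible for $\Lambda$, where $\mathrm{Vol}(\Lambda)$ is the covolume. *)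

(* Defs.v *)
From HB Require Import structures.
From mathcomp Require Import all_boot all_order all_algebra.
From mathcomp Require Import all_classical all_reals all_analysis.
Set Implicit Arguments.
Unset Strict Implicit.
Unset Printing Implicit Defensive.
Import Order.TTheory GRing.Theory Num.Theory.
Import numFieldNormedType.Exports.
Local Open Scope classical_set_scope.
Local Open Scope ring_scope.

Section lattices.
Context {R : realType} {n : nat}.
Implicit Types (A B g : 'M[R]_n) (L : set 'cV[R]_n).

(* R^n is 'cV[R]_n; int_span B is the group generated by the columns of B. *)
Definition int_span B : set 'cV[R]_n :=
  [set B *m map_mx intr z | z in [set: 'cV[int]_n]].

Definition lattice_basis L : set 'M[R]_n :=
  [set B | B \in unitmx /\ L = int_span B].

Definition is_lattice L : Prop := exists B, lattice_basis L B.

(* |det B| for any basis B of L, see covolE; a junk value if L is not a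
   lattice. *)
Definition covol L : R := `|\det (xget 1%:M (lattice_basis L))|.

Lemma int_span_sub A B : A \in unitmx -> int_span A `<=` int_span B ->
  `|\det B| <= `|\det A|.
Proof.
move=> uA sAB.
have /choice [z Hz] (j : 'I_n) :
    exists z : 'cV[int]_n, B *m map_mx intr z = col j A.
  have /sAB [z _ zE] : int_span A (col j A).
    exists (delta_mx j 0) => //.
    by rewrite map_delta_mx colE.
  by exists z.
pose P : 'M[int]_n := \matrix_(i, j) z j i 0.
have AE : A = B *m map_mx intr P.
  apply/matrixP => i j; have /matrixP/(_ i 0) := Hz j.
  rewrite !mxE => <-; apply: eq_bigr => k _; by rewrite !mxE.
rewrite AE det_mulmx normrM det_map_mx ler_peMr// -intr_norm -[1]/(1%:~R).
have : \det A != 0 by rewrite -unitfE -unitmxE.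
rewrite AE det_mulmx mulf_eq0 negb_or det_map_mx intr_eq0 => /andP[_ P0].
by rewrite ler_int -gtz0_ge1 normr_gt0.
Qed.

Lemma covolE B : B \in unitmx -> covol (int_span B) = `|\det B|.
Proof.
move=> uB; rewrite /covol; case: xgetP => [C _ [uC BC]|/(_ B) []]; last first.
  by split.
by apply/eqP; rewrite eq_le !int_span_sub// BC.
Qed.

Lemma int_span_mul g B : (mulmx g) @` int_span B = int_span (g *m B).
Proof.
apply/seteqP; split => [_ [_ [z _ <-] <-]|_ [z _ <-]].
  by exists z => //; rewrite mulmxA.
by exists (B *m map_mx intr z); [exists z|rewrite mulmxA].
Qed.

Definition sym_box (a : 'I_n -> R) : set 'cV[R]_n :=
  [set x | forall i, - a i <= x i 0 <= a i].

Definition sym_box_vol (a : 'I_n -> R) : R := \prod_i (2 * a i).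

Definition admissible L (a : 'I_n -> R) : Prop :=
  (sym_box a)° `&` L `<=` [set 0].

(* The supremum is taken in \bar R, so that it has no junk value. *)
Definition mordell_constant L : \bar R :=
  ereal_sup [set (sym_box_vol a / (2 ^+ n * covol L))%:E |
             a in [set a | (forall i, 0 < a i) /\ admissible L a]].

End lattices.

Section space_of_lattices.
Variables (R : realType) (n : nat).

Definition SL : Type := set_type [set g : 'M[R]_n | \det g = 1].
HB.instance Definition _ := Topological.on SL.

Definition lattice_space : Type :=
  {L : set 'cV[R]_n | is_lattice L /\ covol L = 1}.

Lemma SL_det (g : SL) : \det (\val g) = 1.
Proof. by have /set_mem := valP g. Qed.

Lemma SL_unit (g : SL) : \val g \in unitmx.
Proof. by rewrite unitmxE SL_det unitr1. Qed.

Lemma lattice_of_SL_subproof (g : SL) :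
  is_lattice (int_span (\val g)) /\ covol (int_span (\val g)) = 1.
Proof.
split; first by exists (\val g); split; rewrite ?SL_unit.
by rewrite covolE ?SL_unit// SL_det normr1.
Qed.

(* g |-> g Z^n; it induces SL_n(R) / SL_n(Z) ~ lattice_space. *)
Definition lattice_of_SL (g : SL) : lattice_space :=
  exist _ (int_span (\val g)) (lattice_of_SL_subproof g).

Lemma lattice_of_SL_surj (L : lattice_space) :
  (0 < n)%N -> exists g, lattice_of_SL g = L.
Proof.
move=> n0; case: L => L [[B [uB LB]] cL].
have [C LC dC] : exists2 C, L = int_span C & \det C = 1.
  have := cL; rewrite {1}LB covolE// => /eqP; rewrite eqr_norml ler01 andbT.
  case/orP => /eqP dB; first by exists B.
  pose D : 'M[int]_n :=
    diag_mx (\row_i (if i == Ordinal n0 then - 1 else 1)).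
  have DD : D *m D = 1%:M.
    apply/matrixP => i j; rewrite mul_diag_mx !mxE.
    by case: (i == Ordinal n0); case: (i == j).
  have dD : \det D = -1.
    rewrite det_diag (bigD1 (Ordinal n0))//= mxE eqxx big1 ?mulr1// => i.
    by rewrite mxE => /negbTE ->.
  exists (B *m map_mx intr D); last first.
    by rewrite det_mulmx det_map_mx dB dD rmorphN1 mulrNN mulr1.
  rewrite LB; apply/seteqP; split => _ [z _ <-].
    by exists (D *m z) => //; rewrite -mulmxA -map_mxM mulmxA DD mul1mx.
  by exists (D *m z) => //; rewrite map_mxM mulmxA.
exists (exist _ C (mem_set dC)); apply: eq_exist => /=; exact/esym.
Qed.

Lemma SL_act_subproof (g : SL) (L : lattice_space) :
  is_lattice (mulmx (\val g) @` sval L) /\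
  covol (mulmx (\val g) @` sval L) = 1.
Proof.
case: L => L /= [[B [uB ->]]].
have ugB : \val g *m B \in unitmx by rewrite unitmx_mul SL_unit.
rewrite int_span_mul !covolE// det_mulmx SL_det mul1r => ->; split => //.
by exists (\val g *m B).
Qed.

Definition SL_act (g : SL) (L : lattice_space) : lattice_space :=
  exist _ (mulmx (\val g) @` sval L) (SL_act_subproof g L).

Lemma SL1_subproof : 1%:M \in [set g : 'M[R]_n | \det g = 1].
Proof. by rewrite inE /= det1. Qed.

HB.instance Definition _ := gen_eqMixin lattice_space.
HB.instance Definition _ := gen_choiceMixin lattice_space.
HB.instance Definition _ :=
  isPointed.Build lattice_space (lattice_of_SL (exist _ 1%:M SL1_subproof)).

(* Since lattice_of_SL is onto, this is the quotient topology of
   SL_n(R) / SL_n(Z). *)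
Definition lattice_open (U : set lattice_space) : Prop :=
  open (lattice_of_SL @^-1` U).

Lemma lattice_openT : lattice_open setT.
Proof. by rewrite /lattice_open preimage_setT; exact: openT. Qed.

Lemma lattice_openI (U V : set lattice_space) :
  lattice_open U -> lattice_open V -> lattice_open (U `&` V).
Proof. exact: openI. Qed.

Lemma lattice_open_bigcup (I : Type) (f : I -> set lattice_space) :
  (forall i, lattice_open (f i)) -> lattice_open (\bigcup_i f i).
Proof. by move=> fo; apply: bigcup_open => i _; exact: fo. Qed.

HB.instance Definition _ := isOpenTopological.Build lattice_space
  lattice_openT lattice_openI lattice_open_bigcup.

Definition borel_lattice_space :=
  g_sigma_algebraType (@open lattice_space).

Definition SL_invariant (mu : {measure set borel_lattice_space -> \bar R}) :
    Prop :=
  forall (g : SL) (A : set borel_lattice_space), measurable A ->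
    mu (SL_act g @^-1` A) = mu A.

End space_of_lattices.

(* Main.v *)
Require Import Defs.
From mathcomp Require Import all_boot all_order all_fingroup all_algebra.
From mathcomp Require Import all_classical all_reals all_analysis.
From mathcomp Require Import lra zify.
Set Implicit Arguments.
Unset Strict Implicit.
Unset Printing Implicit Defensive.
Import Order.TTheory GRing.Theory Num.Theory.
Import numFieldNormedType.Exports.
Local Open Scope classical_set_scope.
Local Open Scope ring_scope.

(* The upper bound is Minkowski's theorem for boxes.  For an integer matrix P,
   the Smith normal form shows that P Z^n has index |det P| in Z^n, and the
   pigeonhole principle applies; a real matrix is approximated by rational ones.

   For the lower bound let c < 1 and let E be the set of lattices avoiding some
   open box of normalised volume greater than c.  It is open, contains Z^n, and
   is invariant under the diagonal matrices of determinant 1.  If u is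
   unitriangular, then d^-1 u d tends to 1 for suitable diagonal d, while
   mu (E \ u E) is unchanged by this conjugation; as E is open,
   mu (E \ v E) tends to 0 as v tends to 1, so that mu (E \ u E) = 0 (the
   Mautner phenomenon).  By the PLU decomposition mu (E \ g E) = 0 for all g in
   SL_n(R).  Since countably many translates of E cover the space of lattices,
   E has full measure. *)

(** * Minkowski's theorem for integer matrices *)

Lemma card_prod_ord n (m : 'I_n -> nat) :
  #|{dffun forall i : 'I_n, 'I_(m i)}| = (\prod_i m i)%N.
Proof.
rewrite card_dep_ffun foldrE big_map -big_enum /=.
by apply: eq_bigr => i _; rewrite card_ord.
Qed.

(** Pigeonhole on the points with coordinates 0 <= y_i < m_i: if they outnumber the classes of Z^n
    modulo P Z^n, two are congruent, and their difference is P z with z nonzero and entries smaller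
    than m_i in absolute value. *)
Lemma int_minkowski_nat n (P : 'M[int]_n) (m : 'I_n -> nat) :
  \det P != 0 ->
  (forall z : 'cV[int]_n, (forall i, `|(P *m z) i 0| < (m i)%:Z) -> z = 0) ->
  (\prod_i m i <= `|\det P|)%N.
Proof.
move=> P0 Pm.
have [U uU [V uV [d _ PE]]] := int_Smith_normal_form P.
set D := (\matrix_(i, j) _) in PE.
have DE : D = diag_mx (\row_i d`_i).
  by apply/matrixP => i j; rewrite !mxE.
have detP : `|\det P|%N = (\prod_(i < n) `|(d`_i)%R|)%N.
  have unit1 (W : 'M[int]_n) : W \in unitmx -> `|\det W|%N = 1%N.
    by rewrite unitmxE qualifE => /orP[] /eqP ->.
  rewrite PE !det_mulmx !abszM (unit1 U)// (unit1 V)// mul1n muln1 DE det_diag.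
  rewrite (big_morph absz abszM (erefl _)).
  by apply: eq_bigr => i _; rewrite mxE.
have d0 (i : 'I_n) : d`_i != 0.
  apply: contraNneq P0 => di.
  by rewrite -absz_eq0 detP (bigD1 i)//= di absz0 mul0n.
(* Equal to |d_i|, but written as a successor because [inord] needs a visibly nonempty ordinal
   type. *)
pose q (i : 'I_n) := `|(d`_i)%R|.-1.+1%N.
have qE i : q i = `|(d`_i)%R|%N by rewrite /q prednK// absz_gt0.
rewrite leqNgt; apply/negP => lt_det.
pose T := {dffun forall i : 'I_n, 'I_(m i)}.
pose T' := {dffun forall i : 'I_n, 'I_(q i)}.
pose vec (y : T) : 'cV[int]_n := \col_i (y i : nat)%:Z.
(* As P = U D V, the residues of the coordinates of U^-1 y modulo the d_i determine the class of y
   modulo P Z^n. *)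
pose f (y : T) : T' :=
  [ffun i => inord (absz (modz ((invmx U *m vec y) i 0) d`_i))].
have /injectivePn[y [y' yy' fyy']] : ~~ injectiveb f.
  apply/negP => /injectiveP /leq_card.
  rewrite !card_prod_ord leqNgt => /negP; apply.
  by under eq_bigr do rewrite qE; rewrite -detP.
have modE i : modz ((invmx U *m vec y) i 0) d`_i =
    modz ((invmx U *m vec y') i 0) d`_i.
  have /ffunP/(_ i) := fyy'; rewrite !ffunE => /(congr1 val).
  have lt_mod w : (absz (modz w (d`_i)%R) < q i)%N.
    rewrite qE -ltz_nat gez0_abs ?modz_ge0//; exact: ltz_mod.
  rewrite /= !inordK// => /(congr1 Posz).
  by rewrite !gez0_abs ?modz_ge0.
pose w : 'cV[int]_n := \col_i divz ((invmx U *m (vec y - vec y')) i 0) d`_i.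
have Dw : D *m w = invmx U *m (vec y - vec y').
  apply/matrixP => i j; rewrite ord1 DE mul_diag_mx mxE [X in X * _]mxE.
  rewrite [w _ _]mxE mulrC divzK// mulmxBr mxE [X in _ + X]mxE -eqz_mod_dvd.
  exact/eqP.
have yE : P *m (invmx V *m w) = vec y - vec y'.
  by rewrite PE -!mulmxA mulKVmx// Dw mulKVmx.
have z0 : invmx V *m w = 0.
  apply: Pm => i; rewrite yE !mxE.
  have := ltn_ord (y i); have := ltn_ord (y' i).
  move: (nat_of_ord (y i)) (nat_of_ord (y' i)) => u v.
  rewrite -[X in `|X|]/(u%:Z - v%:Z) ltr_norml; lia.
move: yE; rewrite z0 mulmx0 => /esym/eqP; rewrite subr_eq0 => /eqP vyy'.
move/eqP: yy'; apply; apply/ffunP => i; apply/val_inj => /=.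
by have /matrixP/(_ i 0) := vyy'; rewrite !mxE => -[].
Qed.

(** * Real side lengths and perturbation of boxes *)

Section minkowski.
Variable R : realType.

(** The entries of P z are integers, so rounding each b_i up to an integer leaves the condition on z
    unchanged and only enlarges the product. *)
Lemma int_minkowski n (P : 'M[int]_n) (b : 'I_n -> R) :
  \det P != 0 -> (forall i, 0 < b i) ->
  (forall z : 'cV[int]_n, (forall i, `|(P *m z) i 0|%:~R < b i) -> z = 0) ->
  \prod_i b i <= `|\det P|%:~R.
Proof.
move=> P0 b0 Pb.
have c0 i : 0 < Num.ceil (b i) by rewrite ceil_gt0.
apply: (@le_trans _ _ (\prod_i `|Num.ceil (b i)|%N)%:R).
  rewrite natr_prod; apply: ler_prod => i _.
  rewrite ltW//= -[X in _ <= X]/(`|Num.ceil (b i)|%N%:~R) gtz0_abs//.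
  exact: ceil_ge.
rewrite -abszE -[X in _ <= X]/(`|\det P|%N%:R) ler_nat.
apply: int_minkowski_nat => // z Hz; apply: Pb => i.
by have := Hz i; rewrite gtz0_abs// ceil_gt_int.
Qed.

Lemma shrink_factor n (c p : R) : c < p ->
  exists2 s, 0 < s < 1 & c < s ^+ n * p.
Proof.
move=> cp.
have cont : {for 1, continuous (fun s : R => s ^+ n * p)}.
  by apply: continuousM; [exact: exprn_continuous|exact: cvg_cst].
have : nbhs (1 : R) [set s | c < s ^+ n * p].
  by apply: (cont [set y | c < y]); apply: lt_nbhsr; rewrite expr1n mul1r.
move=> /nbhs_ballP[e /= e0 He].
exists (1 - Num.min (e / 2) (1 / 2)).
  by rewrite /Num.min; case: ifP => ?; apply/andP; split; lra.
apply: He; rewrite /ball/=.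
rewrite opprB addrC subrK ger0_norm /Num.min; by case: ifP => ?; lra.
Qed.

(** With y = g z one has y = h z + (g - h) g^-1 y. At the coordinate where |y_i| / a_i attains its
    maximum t, this gives t < s + t (1 - s), hence t < 1. *)
Lemma perturb_box n (g : 'M[R]_n) (a : 'I_n -> R) (s : R) :
  g \in unitmx -> (forall i, 0 < a i) -> 0 < s < 1 ->
  exists2 e : R, 0 < e & forall h : 'M[R]_n,
    (forall i j, `|(h - g) i j| < e) -> forall z : 'cV[R]_n,
    (forall i, `|(h *m z) i 0| < s * a i) -> forall i, `|(g *m z) i 0| < a i.
Proof.
move=> ug a0 /andP[s0 s1].
pose C := \sum_j \sum_k `|invmx g k j| * a j.
have C0 : 0 <= C.
  by apply: sumr_ge0 => j _; apply: sumr_ge0 => k _; rewrite mulr_ge0// ltW.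
have F0 i : 0 <= C / ((1 - s) * a i).
  by rewrite divr_ge0// mulr_ge0 ?ltW// subr_gt0.
(* The sum dominates each of its terms, so e C <= (1 - s) a_i for all i at once; the added 1 keeps
   the inverted quantity positive. *)
pose e := (1 + \sum_i C / ((1 - s) * a i))^-1.
have e0 : 0 < e by rewrite invr_gt0 ltr_wpDr// sumr_ge0.
have eC i : e * C <= (1 - s) * a i.
  have sa : 0 < (1 - s) * a i by rewrite mulr_gt0// subr_gt0.
  rewrite -[leRHS]mul1r -ler_pdivrMr// -mulrA /e.
  rewrite ler_pdivrMl ?ltr_wpDr ?sumr_ge0//.
  rewrite mulr1 (bigD1 i)//= addrCA lerDl addr_ge0//.
  exact: sumr_ge0.
exists e => // h hg z Hz i.
pose y := g *m z.
have yE : y = h *m z + (g - h) *m (invmx g *m y).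
  by rewrite /y mulKmx// -mulmxDl addrC subrK.
have [i0 _ i0_max] := @arg_maxP _ _ _ i xpredT (fun j => `|y j 0| / a j) isT.
pose t := `|y i0 0| / a i0.
have t0 : 0 <= t by rewrite divr_ge0// ltW.
have yt j : `|y j 0| <= t * a j by rewrite -ler_pdivrMr//; exact: i0_max.
have : `|y i0 0| < s * a i0 + t * ((1 - s) * a i0).
  rewrite {1}yE mxE (le_lt_trans (ler_normD _ _))// ltr_leD//.
  apply: (@le_trans _ _ (t * (e * C))); last by rewrite ler_wpM2l.
  rewrite mulmxA mxE (le_trans (ler_norm_sum _ _ _))//.
  rewrite /C !mulr_sumr; apply: ler_sum => j _; rewrite mxE normrM.
  apply: (@le_trans _ _ (`|\sum_k (g - h) i0 k * invmx g k j| * (t * a j))).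
    by rewrite ler_wpM2l.
  rewrite mulrCA ler_wpM2l// -mulr_suml [leRHS]mulrA (ler_wpM2r (ltW (a0 j)))//.
  rewrite (le_trans (ler_norm_sum _ _ _))// mulr_sumr; apply: ler_sum => k _.
  rewrite normrM ler_wpM2r// -opprB mxE normrN; exact/ltW.
have -> : `|y i0 0| = t * a i0 by rewrite divfK// gt_eqF.
rewrite mulrA -mulrDl ltr_pM2r// mulrBr mulr1 addrCA ltrDl subr_gt0.
rewrite -[ltRHS]mul1r ltr_pM2r// => t1.
by rewrite (le_lt_trans (yt i))// gtr_pMl.
Qed.

End minkowski.

(** * Continuity of matrix products and of the determinant *)

Section matrix_continuity.
Variables (R : realType) (n : nat).
Implicit Types g h : 'M[R]_n.

Lemma continuous_mul (T : topologicalType) (u v : T -> R) :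
  continuous u -> continuous v -> continuous (fun x => u x * v x).
Proof. by move=> cu cv x; exact: cvgM (cu x) (cv x). Qed.

Lemma near_mxP g (S : set 'M[R]_n) : nbhs g S <->
  exists2 e, 0 < e & forall h, (forall i j, `|(h - g) i j| < e) -> S h.
Proof.
split=> [/nbhs_ballP[e /= e0 He]|[e e0 He]].
  exists e => // h gh; apply: He; split=> // i j.
  by have := gh i j; rewrite /ball/= !mxE distrC.
apply/nbhs_ballP; exists e => // h [_ gh]; apply: He => i j.
by have := gh i j; rewrite /ball/= !mxE distrC.
Qed.

Lemma mulmx_continuous (A B : 'M[R]_n) : continuous (fun h => A *m h *m B).
Proof.
move=> g S [P nP PS].
suff : nbhs g [set h | forall i j, P i j ((A *m h *m B) i j)].
  by apply: filterS => h /= Ph; exact: PS.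
pose f h := A *m h *m B.
apply: (@filter_forall _ _ (fun i => [set h | forall j, P i j (f h i j)])
  (nbhs g) _) => i.
apply: (@filter_forall _ _ (fun j => [set h | P i j (f h i j)])
  (nbhs g) _) => j.
suff cont : continuous (fun h => f h i j) by exact: (cont _ _ (nP i j)).
have -> : (fun h => f h i j) = fun h => \sum_k \sum_l A i l * h l k * B k j.
  apply/funext => h; rewrite mxE; apply: eq_bigr => k _.
  by rewrite mxE mulr_suml.
apply: continuous_big => [|k _]; first exact: add_continuous.
apply: continuous_big => [|l _]; first exact: add_continuous.
apply: continuous_mul; last exact: cst_continuous.
apply: continuous_mul; last exact: coord_continuous.
exact: cst_continuous.
Qed.

Lemma det_continuous : continuous (fun h : 'M[R]_n => \det h).
Proof.
rewrite /determinant.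
apply: continuous_big => [|s _]; first exact: add_continuous.
apply: continuous_mul; first exact: cst_continuous.
apply: continuous_big => [|i _]; first exact: mul_continuous.
exact: coord_continuous.
Qed.

End matrix_continuity.

(** * Open boxes and Minkowski's theorem for real matrices *)

Section boxes.
Variables (R : realType) (n : nat).
Implicit Types (g h A : 'M[R]_n) (L : set 'cV[R]_n) (a : 'I_n -> R) (c : R).

Definition avoids L a := forall x : 'cV[R]_n,
  L x -> (forall i, `|x i 0| < a i) -> x = 0.

(** For covolume 1 the factors 2^n cancel, and the product of the a_i is the normalised volume of
    the box. *)
Definition roomy c L := exists a, [/\ forall i, 0 < a i,
  c < \prod_i a i & avoids L a].

Lemma prod_scale (s : R) a : \prod_i (s * a i) = s ^+ n * \prod_i a i.
Proof. by rewrite big_split/= prodr_const card_ord. Qed.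

(** The conclusion z = 0, rather than h z = 0, is the form required by [int_minkowski] when h is a
    rational approximation of g. *)
Lemma near_avoids g a (s : R) : g \in unitmx -> (forall i, 0 < a i) ->
  0 < s < 1 -> avoids (int_span g) a ->
  \forall h \near g, forall z : 'cV[int]_n,
    (forall i, `|(h *m map_mx intr z) i 0| < s * a i) -> z = 0.
Proof.
move=> ug a0 s01 ga; apply/near_mxP.
have [e e0 He] := perturb_box ug a0 s01.
exists e => // h /He {}He z /He hz.
have /(congr1 (mulmx (invmx g))) : g *m map_mx intr z = 0.
  by apply: ga => //; exists z.
rewrite mulKmx// mulmx0 => /matrixP z0; apply/matrixP => i j.
by have /eqP := z0 i j; rewrite !mxE intr_eq0 => /eqP.
Qed.

Lemma near_roomy c g : g \in unitmx -> roomy c (int_span g) ->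
  \forall h \near g, roomy c (int_span h).
Proof.
move=> ug [a [a0 ca ga]]; have [s s01 cs] := shrink_factor n ca.
have s0 : 0 < s by case/andP: s01.
apply: filterS (near_avoids ug a0 s01 ga) => h hs.
exists (fun i => s * a i); split; first by move=> i; rewrite mulr_gt0.
  by rewrite prod_scale.
by move=> _ [z _ <-] /hs ->; rewrite map_mx0 mulmx0.
Qed.

Lemma near_floor g (S : set 'M[R]_n) : nbhs g S ->
  exists m : nat, S (m.+1%:R^-1 *:
    map_mx (fun x => (Num.floor (m.+1%:R * x))%:~R) g).
Proof.
move=> /near_mxP[e e0 He]; exists (Num.trunc e^-1); apply: He => i j.
set m := _.+1; have m0 : 0 < m%:R :> R by rewrite ltr0n.
rewrite !mxE -(ltr_pM2l m0) -{1}[m%:R]ger0_norm ?ler0n// -normrM mulrBr mulrA.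
rewrite divff ?gt_eqF// mul1r distrC ger0_norm ?subr_ge0 ?floor_le//.
apply: (@lt_trans _ _ 1).
  by rewrite ltrBlDl -[X in _ + X]/(1%:~R) -intrD floorD1_gt.
by rewrite -ltr_pdivrMr// mul1r truncnS_gt.
Qed.

(** If the product exceeded 1, a slightly shrunk box would still have product above |det h| and be
    avoided for every h near g. Taking h = P / (m + 1) with P integral and clearing the denominator
    contradicts [int_minkowski]. *)
Lemma minkowski g a : `|\det g| = 1 -> (forall i, 0 < a i) ->
  avoids (int_span g) a -> \prod_i a i <= 1.
Proof.
move=> dg a0 ga; rewrite leNgt; apply/negP => /(shrink_factor n)[s s01 sa].
have s0 : 0 < s by case/andP: s01.
have ug : g \in unitmx.
  by rewrite unitmxE unitfE -normr_eq0 dg oner_eq0.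
have ndet : \forall h \near g, \det h != 0 /\ `|\det h| < s ^+ n * \prod_i a i.
  have cont := cvg_norm (@det_continuous R n g).
  have {}cont := cont (nbhs_filter g).
  have dg0 : 0 < `|\det g| by rewrite dg.
  have dgs : `|\det g| < s ^+ n * \prod_i a i by rewrite dg.
  have near1 : nbhs g [set h | 0 < `|\det h|] := cont _ (lt_nbhsr dg0).
  have near2 : nbhs g [set h | `|\det h| < s ^+ n * \prod_i a i] :=
    cont _ (lt_nbhsl dgs).
  by apply: filterS2 near1 near2 => h /=; rewrite normr_gt0.
have [m /=] := near_floor (filterI (near_avoids ug a0 s01 ga) ndet).
set P := map_mx (fun x => Num.floor (m.+1%:R * x)) g.
have -> : map_mx (fun x => (Num.floor (m.+1%:R * x))%:~R) g =
    map_mx intr P :> 'M[R]_n by apply/matrixP => i j; rewrite !mxE.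
have m0 : 0 < m.+1%:R :> R by rewrite ltr0n.
have mn0 : 0 < m.+1%:R ^+ n :> R by rewrite exprn_gt0.
rewrite detZ exprVn det_map_mx => -[Pa [dP0 dPs]].
move: dP0; rewrite mulf_eq0 negb_or intr_eq0 => /andP[_ dP0].
suff : \prod_i (m.+1%:R * (s * a i)) <= `|\det P|%:~R.
  rewrite !prod_scale -ler_pdivlMl// leNgt => /negP; apply.
  by move: dPs; rewrite normrM ger0_norm ?invr_ge0 ?ltW// intr_norm.
apply: int_minkowski => // [i|z Pz]; first by rewrite !mulr_gt0.
apply: Pa => i; rewrite -scalemxAl -map_mxM mxE normrM ger0_norm;
  last by rewrite invr_ge0 ltW.
by rewrite ltr_pdivrMl// mxE -intr_norm.
Qed.

End boxes.

(** * Translates of the set of roomy lattices and their measurability *)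

Section translates.
Variables (R : realType) (n : nat).
Implicit Types (A B g h : 'M[R]_n) (L : set 'cV[R]_n) (c : R).

Lemma mulmx_image A B L : mulmx A @` (mulmx B @` L) = mulmx (A *m B) @` L.
Proof.
by rewrite image_comp; apply: eq_imagel => x _ /=; rewrite mulmxA.
Qed.

Lemma mul1mx_image L : mulmx 1%:M @` L = L.
Proof.
by rewrite -[RHS]image_id; apply: eq_imagel => x _; rewrite mul1mx.
Qed.

(** A monomial matrix permutes and rescales the coordinate axes, so it maps boxes to boxes;
    determinant of absolute value 1 preserves the volume. *)
Lemma roomy_monomial c (s : 'S_n) (d : 'rV[R]_n) L : `|\det (diag_mx d)| = 1 ->
  roomy c L -> roomy c (mulmx (perm_mx s *m diag_mx d) @` L).
Proof.
rewrite det_diag normr_prod => d1 [a [a0 ca La]].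
have d0 i : 0 < `|d 0 i|.
  rewrite normr_gt0; apply/eqP => di; move/eqP: d1.
  by rewrite (bigD1 i)//= di normr0 mul0r eq_sym oner_eq0.
exists (fun i => `|d 0 (s i)| * a (s i)); split.
- by move=> i; rewrite mulr_gt0.
- have -> : \prod_i (`|d 0 (s i)| * a (s i)) = \prod_i (`|d 0 i| * a i).
    by rewrite [RHS](reindex_perm s).
  by rewrite big_split/= d1 mul1r.
- move=> _ [x Lx <-] xa; rewrite (La x) ?mulmx0// => i.
  have := xa (s^-1 i)%g; rewrite -mulmxA -row_permE mxE mul_diag_mx !mxE permKV.
  by rewrite normrM ltr_pM2l.
Qed.

(* As the action of A is only defined on lattice_space for det A = 1, translates
   are taken at the level of sets; good c A is the translate by A^-1. *)
Definition good c A : set (borel_lattice_space R n) :=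
  [set L | roomy c (mulmx A @` sval L)].

Lemma good_lattice_of_SL c A (g : SL R n) :
  good c A (lattice_of_SL g) = roomy c (int_span (A *m \val g)).
Proof. by rewrite /good/= int_span_mul. Qed.

Lemma good_preimage c A (g : SL R n) :
  SL_act g @^-1` good c A = good c (A *m \val g).
Proof. by apply/seteqP; split=> L; rewrite /good/= mulmx_image. Qed.

Lemma sub_good_monomial c (s : 'S_n) (d : 'rV[R]_n) A :
  `|\det (diag_mx d)| = 1 -> good c A `<=` good c (perm_mx s *m diag_mx d *m A).
Proof.
by move=> d1 L; rewrite /good/= -mulmx_image; exact: roomy_monomial.
Qed.

Lemma measurable_good c A : A \in unitmx -> measurable (good c A).
Proof.
move=> uA; apply: sub_sigma_algebra; rewrite /open/= /lattice_open openE => g.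
rewrite /= good_lattice_of_SL => Ag; rewrite /interior/=.
have uAg : A *m \val g \in unitmx by rewrite unitmx_mul uA SL_unit.
(* The factor 1 gives the base point the shape A g B for which [mulmx_continuous] is stated. *)
have nAg := near_roomy uAg Ag; rewrite -[A *m _]mulmx1 in nAg.
have nbhs_g : nbhs g [set h : SL R n |
    roomy c (int_span (A *m \val h *m 1%:M))].
  exact: (@initial_continuous _ _ \val g _ (mulmx_continuous nAg)).
by apply: filterS nbhs_g => h /=; rewrite mulmx1 -good_lattice_of_SL.
Qed.

End translates.

Lemma PLU_decomposition (F : fieldType) m (A : 'M[F]_m) : (0 < m)%N ->
  exists (s : {perm 'I_m}) (L U : 'M[F]_m),
  [/\ A = perm_mx s *m L *m U,
    (forall i j : 'I_m, (i <= j)%N -> L i j = (i == j)%:R) &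
    forall i j : 'I_m, (j < i)%N -> U i j = 0].
Proof.
case: m A => // m A _.
have := cormen_lup_perm A; have := cormen_lup_correct A.
have := @cormen_lup_lower _ _ A; have := @cormen_lup_upper _ _ A.
case: (cormen_lup A) => [[P L] U]/= Uup Llow PA /is_perm_mxP[s Ps].
exists s^-1%g, L, U; split=> //.
rewrite -mulmxA -[L *m U]PA Ps -mulmxE mulmxA -perm_mxM mulVg perm_mx1.
by rewrite mul1mx.
Qed.

(** * The Mautner phenomenon *)

Section invariant_measure.
Variables (R : realType) (n : nat).
Variable mu : probability (borel_lattice_space R n) R.
Hypotheses (n_gt0 : (0 < n)%N) (mu_inv : SL_invariant mu).
Variable c : R.
Implicit Types A B g u : 'M[R]_n.

Let E : set (borel_lattice_space R n) := good c 1%:M.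

Definition fixes A := mu (E `\` good c A) = 0%E.

Lemma det1_unit A : \det A = 1 -> A \in unitmx.
Proof. by rewrite unitmxE => ->; exact: unitr1. Qed.

Lemma measurable_loss A : \det A = 1 -> measurable (E `\` good c A).
Proof.
move=> dA; apply: measurableD; apply: measurable_good.
  exact: unitmx1.
exact: det1_unit.
Qed.

(** The left-hand set is the preimage under B of the right-hand one, so invariance of the measure
    applies. *)
Lemma SL_act_measure A B : \det A = 1 -> \det B = 1 ->
  mu (good c B `\` good c (A *m B)) = mu (E `\` good c A).
Proof.
move=> dA dB; pose g : SL R n := exist _ B (mem_set dB).
have -> : good c B `\` good c (A *m B) = SL_act g @^-1` (E `\` good c A).
  rewrite -[RHS]/(SL_act g @^-1` E `\` SL_act g @^-1` good c A).
  by rewrite !good_preimage mul1mx.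
by apply: mu_inv; exact: measurable_loss.
Qed.

(** What AB loses from [E] is either lost by B already, or lies in B^-1 of what A loses; both are
    null. *)
Lemma fixes_mul A B : \det A = 1 -> \det B = 1 ->
  fixes A -> fixes B -> fixes (A *m B).
Proof.
move=> dA dB fA fB.
have dAB : \det (A *m B) = 1 by rewrite det_mulmx dA dB mul1r.
apply/(negligibleP mu (measurable_loss dAB)).
apply: (@negligibleS _ _ _ _ ((E `\` good c B) `|`
  (good c B `\` good c (A *m B)))).
  by move=> L [EL nL]; have [gB|ngB] := pselect (good c B L); [right|left].
apply: negligibleU; first exact/(negligibleP mu (measurable_loss dB)).
have mD : measurable (good c B `\` good c (A *m B)).
  by apply: measurableD; apply: measurable_good; exact: det1_unit.
by apply/(negligibleP mu mD); exact: etrans (SL_act_measure dA dB) fA.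
Qed.

Lemma fixes_monomial (s : {perm 'I_n}) (d : 'rV[R]_n) :
  `|\det (diag_mx d)| = 1 -> fixes (perm_mx s *m diag_mx d).
Proof.
move=> d1; rewrite /fixes [X in mu X](_ : _ = set0) ?measure0//.
apply/seteqP; split=> // L [EL]; apply.
by rewrite -[X in good c X]mulmx1; exact: sub_good_monomial EL.
Qed.

(** Here d' is the inverse of d. The loss of u is pulled back by d, which keeps its measure;
    invariance of [E] under d and d' then places the result inside the loss of the conjugate. *)
Lemma le_loss_conj u (d d' : 'rV[R]_n) : \det u = 1 ->
  \det (diag_mx d) = 1 -> diag_mx d' *m diag_mx d = 1%:M ->
  (mu (E `\` good c u) <= mu (E `\` good c (diag_mx d' *m u *m diag_mx d)))%E.
Proof.
move=> du dd d'd.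
have dd' : \det (diag_mx d') = 1.
  by have := det1 R n; rewrite -d'd det_mulmx dd mulr1.
have d_d' : diag_mx d *m diag_mx d' = 1%:M by exact: mulmx1C.
have mono (w : 'rV[R]_n) B : \det (diag_mx w) = 1 ->
    good c B `<=` good c (diag_mx w *m B).
  move=> dw; have := @sub_good_monomial R n c 1%g w B.
  by rewrite perm_mx1 mul1mx; apply; rewrite dw normr1.
rewrite -(SL_act_measure du dd); apply: le_measure; rewrite ?inE.
- apply: measurableD; apply: measurable_good; rewrite ?det1_unit//.
  by rewrite det_mulmx du dd mul1r.
- by apply: measurable_loss; rewrite !det_mulmx du dd dd' !mul1r.
- move=> L [gd ngud]; split.
    by have := mono d' _ dd' _ gd; rewrite d'd.
  move=> /(mono d _ dd); rewrite !mulmxA d_d' mul1mx; exact: ngud.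
Qed.

(** Since [E] is open, each of its lattices is lost by only finitely many v_k. The tail unions [F m]
    of the losses thus decrease to the empty set, and their measures, which bound the loss of u,
    tend to 0. *)
Lemma fixes_limit u (v : nat -> 'M[R]_n) : \det u = 1 ->
  (forall k, \det (v k) = 1) ->
  (forall k, mu (E `\` good c u) <= mu (E `\` good c (v k)))%E ->
  v k @[k --> \oo] --> (1%:M : 'M[R]_n) -> fixes u.
Proof.
move=> du dv le_v v1.
pose F m := \bigcup_(k in [set k | (m <= k)%N]) (E `\` good c (v k)).
have mF m : measurable (F m).
  by apply: bigcup_measurable => k _; exact: measurable_loss.
have capF : \bigcap_m F m = set0.
  apply/seteqP; split=> // L FL.
  (* Any L in E stays in E under small perturbations, so L \in good c (v k)
     for all large k. *)
  have [k0 _ [EL _]] := FL 0%N I.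
  have [g gL] := lattice_of_SL_surj L n_gt0.
  move: EL; rewrite -gL /E good_lattice_of_SL mul1mx => Eg.
  have ng := near_roomy (SL_unit g) Eg.
  have gE : \val g = 1%:M *m 1%:M *m \val g by rewrite !mul1mx.
  rewrite gE in ng.
  have n1 : \forall h \near (1%:M : 'M[R]_n),
      roomy c (int_span (1%:M *m h *m \val g)).
    exact: (mulmx_continuous ng).
  have [m _ Hm] := v1 _ n1.
  have [k mk [_]] := FL m I; apply.
  by rewrite -gL good_lattice_of_SL; have := Hm k mk; rewrite /= mul1mx.
have cvgF : (mu \o F) m @[m --> \oo] --> 0%E.
  rewrite -(measure0 mu) -capF; apply: nonincreasing_cvg_mu => //.
  - by rewrite (le_lt_trans (probability_le1 _ _))// ltry.
  - by rewrite capF.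
  - move=> i j ij; apply/subsetPset => L [k /= jk Lk]; exists k => //=.
    exact: leq_trans jk.
apply/eqP; rewrite eq_le measure_ge0 andbT.
apply: (cvge_to_ge cvgF); apply: nearW => m.
apply: (le_trans (le_v m)); apply: le_measure; rewrite ?inE//.
  exact: measurable_loss.
by move=> L EL; exists m => /=.
Qed.

(** Conjugation multiplies the entry (i, j) of u by d_j / d_i: the unit diagonal stays, and
    off-diagonal entries are at most C / (k + 1), so the conjugates tend to 1. *)
Lemma fixes_contracted u (d : nat -> 'rV[R]_n) : \det u = 1 ->
  (forall i, u i i = 1) ->
  (forall k i, 0 < d k 0 i) -> (forall k, \det (diag_mx (d k)) = 1) ->
  (forall k i j, i != j -> u i j != 0 -> k.+1%:R * d k 0 j <= d k 0 i) ->
  fixes u.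
Proof.
move=> du u1 d0 dd dij.
pose d' k : 'rV[R]_n := \row_i (d k 0 i)^-1.
have d'd k : diag_mx (d' k) *m diag_mx (d k) = 1%:M.
  apply/matrixP => i j; rewrite mul_diag_mx !mxE.
  by case: (i == j); rewrite ?mulr0n ?mulr0// mulr1n mulVf// gt_eqF.
have dd' k : \det (diag_mx (d' k)) = 1.
  by have := det1 R n; rewrite -(d'd k) det_mulmx dd mulr1.
apply: (@fixes_limit u (fun k => diag_mx (d' k) *m u *m diag_mx (d k))) => //.
- by move=> k; rewrite !det_mulmx du dd dd' !mul1r.
- by move=> k; exact: le_loss_conj.
move=> S /near_mxP[e e0 He].
pose C := \sum_i \sum_j `|u i j|.
have uC i j : `|u i j| <= C.
  rewrite /C (bigD1 i)//= (bigD1 j)//= -addrA lerDl addr_ge0//.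
    exact: sumr_ge0.
  by apply: sumr_ge0 => ? _; exact: sumr_ge0.
exists (Num.trunc (C / e)) => // k /= Ck; apply: He => i j.
have k0 : 0 < k.+1%:R :> R by rewrite ltr0n.
have Cek : C / e < k.+1%:R.
  by rewrite (lt_le_trans (truncnS_gt _))// ler_nat.
rewrite mul_mx_diag mul_diag_mx !mxE.
have [<-|ij] := eqVneq i j.
  by rewrite u1 mulr1 mulVf ?subrr ?normr0// gt_eqF.
rewrite subr0; have [->|uij] := eqVneq (u i j) 0.
  by rewrite mulr0 mul0r normr0.
rewrite !normrM normfV !(gtr0_norm (d0 _ _)).
apply: (@le_lt_trans _ _ (C / k.+1%:R)); last first.
  by rewrite ltr_pdivrMr// mulrC -ltr_pdivrMr.
rewrite mulrAC mulrC; apply: ler_pM => //.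
  by rewrite mulr_ge0 ?invr_ge0 ?ltW.
by rewrite mulrC ler_pdivrMr// ler_pdivlMl//; exact: dij.
Qed.

(** The function f orders the indices so that lower and upper unitriangular matrices are treated
    together, with f the index or the reversed index. *)
Lemma fixes_triangular u (f : 'I_n -> nat) :
  (forall i, f i + f (rev_ord i) = n.-1)%N -> \det u = 1 ->
  (forall i, u i i = 1) ->
  (forall i j, i != j -> u i j != 0 -> (f j < f i)%N) -> fixes u.
Proof.
move=> f_rev du u1 fu.
(* The division by the reversed weight makes the determinant 1, as reversal is a bijection; it
   preserves the inequality between entries because [f \o rev_ord] decreases when f increases. *)
pose d k : 'rV[R]_n := \row_i (k.+1%:R ^+ f i / k.+1%:R ^+ f (rev_ord i)).
have t0 k : 0 < k.+1%:R :> R by rewrite ltr0n.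
apply: (@fixes_contracted u d) => //.
- by move=> k i; rewrite mxE divr_gt0 ?exprn_gt0.
- move=> k; rewrite det_diag; under eq_bigr do rewrite mxE.
  rewrite big_split/= prodfV.
  have -> : \prod_i k.+1%:R ^+ f (rev_ord i) = \prod_i k.+1%:R ^+ f i :> R.
    by rewrite [RHS](reindex_inj rev_ord_inj).
  by rewrite divff// gt_eqF// prodr_gt0// => i _; rewrite exprn_gt0.
- move=> k i j ij /(fu _ _ ij) fij; rewrite !mxE mulrA -exprS.
  have k1 : 1 <= k.+1%:R :> R by rewrite ler1n.
  apply: ler_pM; rewrite ?invr_ge0 ?exprn_ge0 ?(ltW (t0 k))//.
    by rewrite ler_weXn2l.
  rewrite ler_pV2 ?inE ?unitfE ?exprn_gt0 ?expf_neq0 ?gt_eqF//.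
  rewrite ler_weXn2l//.
  have := f_rev i; have := f_rev j; lia.
Qed.

(** * Generation of SL_n(R) by monomial and unitriangular matrices *)

Lemma fixes_lower u : (forall i j : 'I_n, (i <= j)%N -> u i j = (i == j)%:R) ->
  \det u = 1 /\ fixes u.
Proof.
move=> ulow.
have u1 i : u i i = 1 by rewrite ulow// eqxx.
have du : \det u = 1.
  rewrite det_trig; first by rewrite big1.
  by apply/is_trig_mxP => i j ij; rewrite ulow ?(ltnW ij)// -val_eqE /= ltn_eqF.
split=> //; apply: (@fixes_triangular u val) => // [i|i j ij].
  by rewrite /=; have := ltn_ord i; lia.
by rewrite ltnNge; apply: contraNN => /ulow ->; rewrite (negbTE ij).
Qed.

Lemma fixes_upper u : (forall i j : 'I_n, (j <= i)%N -> u i j = (i == j)%:R) ->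
  \det u = 1 /\ fixes u.
Proof.
move=> uup.
have u1 i : u i i = 1 by rewrite uup// eqxx.
have du : \det u = 1.
  rewrite -det_tr det_trig; first by rewrite big1// => i _; rewrite mxE.
  by apply/is_trig_mxP => i j ij; rewrite mxE uup ?(ltnW ij)//
    -val_eqE /= gtn_eqF.
split=> //; apply: (@fixes_triangular u (val \o @rev_ord n)) => // [i|i j ij].
  by rewrite /=; have := ltn_ord i; lia.
move=> uij; have : ~~ (j <= i)%N.
  by apply: contraNN uij => /uup ->; rewrite (negbTE ij).
by rewrite /=; have := ltn_ord i; have := ltn_ord j; lia.
Qed.

Lemma fixes_det1 A : \det A = 1 -> fixes A.
Proof.
move=> dA.
have [s [L [U [AE Llow Uup]]]] := PLU_decomposition A n_gt0.
have [dL _] := fixes_lower Llow.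
pose d : 'rV[R]_n := \row_i U i i.
pose d' : 'rV[R]_n := \row_i (U i i)^-1.
have dU : \det U = \det (diag_mx d).
  rewrite -det_tr det_trig; last first.
    by apply/is_trig_mxP => i j ij; rewrite mxE Uup.
  by rewrite det_diag; apply: eq_bigr => i _; rewrite !mxE.
have dsU : \det (perm_mx s *m diag_mx d) = 1.
  by rewrite -dA AE !det_mulmx dL mulr1 dU.
have dd1 : `|\det (diag_mx d)| = 1.
  have := congr1 Num.norm dsU; rewrite det_mulmx normrM det_perm normrX.
  by rewrite normrN1 expr1n mul1r normr1.
have U0 i : U i i != 0.
  apply: contra_eqN dd1 => /eqP Ui.
  by rewrite det_diag (bigD1 i)//= mxE Ui mul0r normr0 eq_sym oner_eq0.
have dd' : diag_mx d *m diag_mx d' = 1%:M.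
  apply/matrixP => i j; rewrite mul_diag_mx !mxE.
  by case: (i == j); rewrite ?mulr0n ?mulr0// mulr1n mulfV.
(* The diagonal d of U moves to the left past L. This leaves a monomial factor of determinant 1,
   even if the permutation is odd, times a lower and an upper unitriangular factor. *)
have -> : A = perm_mx s *m diag_mx d *m
    ((diag_mx d' *m L *m diag_mx d) *m (diag_mx d' *m U)).
  rewrite AE -!mulmxA; congr (_ *m _).
  by rewrite !(mulmxA (diag_mx d)) dd' !mul1mx.
have [dL' fL'] : \det (diag_mx d' *m L *m diag_mx d) = 1 /\
    fixes (diag_mx d' *m L *m diag_mx d).
  apply: fixes_lower => i j ij.
  rewrite mul_mx_diag mul_diag_mx !mxE Llow//.
  by case: eqVneq => [<-|]; rewrite ?mulr0 ?mul0r// mulr1 mulVf.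
have [dU' fU'] : \det (diag_mx d' *m U) = 1 /\ fixes (diag_mx d' *m U).
  apply: fixes_upper => i j; rewrite leq_eqVlt mul_diag_mx !mxE.
  case: eqVneq => [/val_inj ->|ji /= ij]; first by rewrite eqxx mulVf.
  by rewrite (Uup i j ij) mulr0 -val_eqE eq_sym (negbTE ji).
apply: fixes_mul; [exact: dsU| |exact: fixes_monomial|exact: fixes_mul].
by rewrite (det_mulmx (diag_mx d' *m L *m _)) dL' dU' mulr1.
Qed.

(* A countable dense family in SL_n(R): a matrix of SL_n(R) in the cube of side
   1 / (p.2 + 1) given by p, or the identity if there is none. *)
Definition net (p : 'M[int]_n * nat) : 'M[R]_n := xget 1%:M [set B |
  \det B = 1 /\ forall i j, Num.floor (p.2.+1%:R * B i j) = p.1 i j].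

Lemma det_net p : \det (net p) = 1.
Proof. by rewrite /net; case: xgetP => [B -> [->//]|_]; rewrite det1. Qed.

Lemma net_dense g (S : set 'M[R]_n) : \det g = 1 -> nbhs g S ->
  exists p, S (net p).
Proof.
move=> dg /near_mxP[e e0 He].
pose m := Num.trunc e^-1; have m0 : 0 < m.+1%:R :> R by rewrite ltr0n.
(* Entries with equal floors after scaling by m + 1 differ by less than 1 / (m + 1) < e; g itself
   witnesses that the cell is not empty. *)
exists (map_mx (fun x => Num.floor (m.+1%:R * x)) g, m); apply: He => i j.
rewrite /net; case: xgetP => [B _ [_ /= /(_ i j)]|/(_ g)[]]; last first.
  by split=> // k l; rewrite mxE.
rewrite !mxE => Bg; rewrite -(ltr_pM2l m0) -{1}[m.+1%:R]gtr0_norm// -normrM.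
rewrite mulrBr; apply: (@lt_trans _ _ 1); last first.
  by rewrite -ltr_pdivrMr// mul1r truncnS_gt.
have /andP[B1 B2] := floor_itv (m.+1%:R * B i j).
have /andP[g1 g2] := floor_itv (m.+1%:R * g i j).
rewrite ltr_norml; move: B1 B2 g1 g2; rewrite Bg intrD => *.
by apply/andP; split; lra.
Qed.

(** * Full measure of the set of roomy lattices *)

Lemma roomy_standard : c < 1 -> roomy c (int_span (1%:M : 'M[R]_n)).
Proof.
move=> c1; exists (fun=> 1); split=> //; first by rewrite big1.
move=> _ [z _ <-]; rewrite mul1mx => z1.
suff -> : z = 0 by rewrite map_mx0.
apply/matrixP => i j; rewrite ord1 [RHS]mxE; have := z1 i.
by rewrite mxE -intr_norm -[X in _ < X]/(1%:~R) ltr_int; lia.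
Qed.

(** For L = g Z^n, a net matrix p close to g^-1 brings p L close to Z^n, which is roomy. So the
    translates of [E] by the net cover everything, and each exceeds [E] only by a null set. *)
Lemma ae_roomy : c < 1 -> {ae mu, forall L, roomy c (sval L)}.
Proof.
move=> c1.
(* Codes k of no pair receive the net matrix of (0, 0), which also has determinant 1. *)
pose C k := net (odflt (0, 0%N) (unpickle k)).
apply: (@negligibleS _ _ _ _ (\bigcup_k (good c (C k) `\` E))); last first.
  apply: negligible_bigcup => k.
  have dC : \det (C k) = 1 by exact: det_net.
  have dC' : \det (invmx (C k)) = 1 by rewrite det_inv dC invr1.
  (* In this form, what C^-1 E has outside [E] is the translate by C^-1 of the loss of the matrix
     C^-1. *)
  have EE : E = good c (invmx (C k) *m C k) by rewrite mulVmx ?det1_unit.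
  have mD : measurable (good c (C k) `\` E).
    by apply: measurableD; apply: measurable_good; rewrite ?unitmx1 ?det1_unit.
  apply/(negligibleP mu mD); rewrite EE.
  exact: etrans (SL_act_measure dC' dC) (fixes_det1 dC').
move=> L /= nL.
have [g gL] := lattice_of_SL_surj L n_gt0.
have ng := near_roomy (unitmx1 R n) (roomy_standard c1).
have gE : 1%:M = 1%:M *m invmx (\val g) *m \val g.
  by rewrite mul1mx mulVmx ?SL_unit.
rewrite gE in ng.
have dg : \det (invmx (\val g)) = 1 by rewrite det_inv SL_det invr1.
have [p Sp] := net_dense dg (mulmx_continuous ng).
exists (pickle p) => //; split; last first.
  by rewrite /E /good/= mul1mx_image.
by rewrite /C pickleK/= -gL good_lattice_of_SL; move: Sp; rewrite /= mul1mx.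
Qed.

End invariant_measure.

(** * From roomy lattices to the Mordell constant *)

Lemma mordell_constant_roomy (R : realType) (n : nat) (g : SL R n) :
  (forall k, roomy (1 - k.+1%:R^-1) (int_span (\val g))) ->
  mordell_constant (int_span (\val g)) = 1%:E.
Proof.
move=> groom.
have volE (a : 'I_n -> R) :
    sym_box_vol a / (2 ^+ n * covol (int_span (\val g))) = \prod_i a i.
  rewrite covolE ?SL_unit// SL_det normr1 mulr1 /sym_box_vol prod_scale.
  by rewrite mulrC mulKf// expf_neq0.
apply/eqP; rewrite eq_le; apply/andP; split.
  apply: ge_ereal_sup => _ [a [a0 ga] <-]; rewrite volE lee_fin.
  apply: (@minkowski _ _ (\val g) a _ a0); first by rewrite SL_det normr1.
  move=> x gx xa; apply: ga; split=> //.
  (* A product of entrywise neighbourhoods inside the closed box shows that x is interior to it. *)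
  exists (fun i j => [set y | - a i <= y <= a i]) => [i j|y ya].
    rewrite ord1; have := xa i; rewrite ltr_norml => /andP[x1 x2].
    apply: filterS2 (lt_nbhsr x1) (lt_nbhsl x2) => y /= y1 y2.
    by rewrite !ltW.
  by move=> i; exact: ya.
apply/lee_addgt0Pr => e e0.
have [a [a0 ka ga]] := groom (Num.trunc e^-1).
(* Shrinking by s < 1 puts the closed box inside the avoided open one, which makes it admissible,
   while its volume stays above 1 - 1 / (k + 1) > 1 - e for k = [Num.trunc e^-1]. *)
have [s /andP[s0 s1] ks] := shrink_factor n ka.
apply: (@le_trans _ _ ((s ^+ n * \prod_i a i)%:E + e%:E)%E).
  rewrite -EFinD lee_fin -lerBlDr (le_trans _ (ltW ks))// lerD2l lerN2.
  rewrite -[leRHS]invrK lef_pV2 ?posrE ?invr_gt0 ?ltr0n//.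
  by rewrite ltW// truncnS_gt.
rewrite leeD2r//; apply: ereal_sup_ubound.
exists (fun i => s * a i); last by rewrite volE prod_scale.
split=> [i|x [/interior_subset xa gx]]; first by rewrite mulr_gt0.
apply: ga => // i; have := xa i; rewrite -ler_norml => /le_lt_trans; apply.
by rewrite gtr_pMl.
Qed.

Theorem corollary1p3 (R : realType) (n : nat) (hn : (0 < n)%N)
    (mu : probability (borel_lattice_space R n) R)
    (hmu : SL_invariant mu) :
  {ae mu, forall L : borel_lattice_space R n,
    mordell_constant (sval L) = 1%:E}.
Proof.
(* The levels 1 - 1 / (k + 1) form a countable family approaching 1, so a single null set serves for
   all of them. *)
have /ae_foralln : forall k : nat,
    {ae mu, forall L, roomy (1 - k.+1%:R^-1) (sval L)}.
  by move=> k; apply: ae_roomy => //; rewrite ltrBlDr ltrDl invr_gt0 ltr0n.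
apply: filterS => L HL.
have [g gL] := lattice_of_SL_surj L hn.
by move: HL; rewrite -gL; exact: mordell_constant_roomy.
Qed.
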